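(* Let $\bar u_-\in C^3([0,1])$ with $\min_{[0,1]}\bar u_->0$, let a constant $\bar P_-(1)>0$ be given, and let $\bar M_-:[0,1]\to(0,\infty)$ be an upstream Mach number profile with $\bar M_-(1)>1$. There exist special normal transonic shock solutions $(\bar{\bm U}_\pm(x_2),\bar x_s)$ (with upstream velocity $\bar u_-$, upstream Mach number $\bar M_-$, upstream pressure equal to the prescribed value $\bar P_-(1)$ at $x_2=1$, and $\bar x_s\in(0,L)$) such that the steady rotating Euler system and the Rankine–Hugoniot conditions $$\bar\rho_+\bar u_+=\bar\rho_-\bar u_-,\qquad \bar\rho_+\bar u_+^2+\bar P_+=\bar\rho_-\bar u_-^2+\bar P_-,\qquad \tfrac12\bar u_+^2+\frac{\gamma\bar P_+}{(\gamma-1)\bar\rho_+}=\tfrac12\bar u_-^2+\frac{\gamma\bar P_-}{(\gamma-1)\bar\rho_-}$$ are satisfied for $x_2\in[0,1]$ if and only if $$\Big(\frac1{\bar M_-^2}\Big)'(x_2)=\frac{\beta\gamma}{\bar u_-(x_2)}\Big(\frac1{\bar M_-^2(x_2)}-1\Big),\qquad x_2\in[0,1].$$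
   Context: Constants: $\beta>0$ (Coriolis parameter), $\gamma>1$ (adiabatic exponent), $L>0$ (nozzle length). The two-dimensional steady compressible rotating Euler system for $(\rho,u_1,u_2,P)$ is $$\begin{cases}\partial_{x_1}(\rho u_1)+\partial_{x_2}(\rho u_2)=0,\\ \partial_{x_1}(\rho u_1^2+P)+\partial_{x_2}(\rho u_1u_2)-\beta\rho u_2=0,\\ \partial_{x_1}(\rho u_1u_2)+\partial_{x_2}(\rho u_2^2+P)+\beta\rho u_1=0,\\ \partial_{x_1}(\rho u_1E+u_1P)+\partial_{x_2}(\rho u_2E+u_2P)=0,\end{cases}\qquad E=\tfrac12(u_1^2+u_2^2)+\frac{P}{(\gamma-1)\rho}.$$ The flat nozzle is $\bar\Omega=\{0<x_1<L,\ 0<x_2<1\}$. For a shock location $\bar x_s\in(0,L)$ put $\bar\Omega_-=\bar\Omega\cap\{x_1<\bar x_s\}$ and $\bar\Omega_+=\bar\Omega\cap\{x_1>\bar x_s\}$. A special normal transonic shock solution consists of states depending only on $x_2$, $$\bar{\bm U}_-(x_2)=(\bar\rho_-(x_2),\bar u_-(x_2),0,\bar P_-(x_2))\ \text{in }\bar\Omega_-,\qquad \bar{\bm U}_+(x_2)=(\bar\rho_+(x_2),\bar u_+(x_2),0,\bar P_+(x_2))\ \text{in }\bar\Omega_+,$$ of class $C^1$ with positive densities, pressures and horizontal velocities, each solving the system in its region, supersonic upstream (Mach number $>1$) and subsonic downstream (Mach number $<1$). The upstream Mach number is $\bar M_-(x_2)=\bar u_-/\sqrt{\gamma\bar P_-/\bar\rho_-}$,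 and the downstream Mach number is defined in the same way with $+$. *)

(* Defs.v *)
From Stdlib Require Import Reals.
From Coquelicot Require Import Coquelicot.

Open Scope R_scope.

Definition I01 (x : R) : Prop := 0 <= x <= 1.

(* C^k([0,1]) for the restriction of f to [0,1]: D_in and continue_in are taken
   within [0,1], hence one-sided at 0 and 1. *)
Fixpoint Ck01 (k : nat) (f : R -> R) : Prop :=
  match k with
  | O => forall x, I01 x -> continue_in f I01 x
  | S k' => exists f' : R -> R,
      (forall x, I01 x -> D_in f f' I01 x) /\ Ck01 k' f'
  end.

Definition is_min01 (f : R -> R) (m : R) : Prop :=
  (exists x, I01 x /\ f x = m) /\ (forall x, I01 x -> m <= f x).

Record flow := Flow {
  rho : R -> R -> R;
  u1 : R -> R -> R;
  u2 : R -> R -> R;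
  prs : R -> R -> R }.

Definition energy (gamma : R) (W : flow) (x1 x2 : R) : R :=
  / 2 * (u1 W x1 x2 ^ 2 + u2 W x1 x2 ^ 2)
  + prs W x1 x2 / ((gamma - 1) * rho W x1 x2).

(* d_{x1} F + d_{x2} G + s = 0 at (x1, x2); both partial derivatives are
   required to exist. *)
Definition balance (F G : R -> R -> R) (s x1 x2 : R) : Prop :=
  exists a b : R,
    is_derive (fun y => F y x2) x1 a /\
    is_derive (fun y => G x1 y) x2 b /\
    a + b + s = 0.

Definition euler_at (beta gamma : R) (W : flow) (x1 x2 : R) : Prop :=
  let r := rho W in let v1 := u1 W in let v2 := u2 W in
  let P := prs W in let E := energy gamma W in
  balance (fun y z => r y z * v1 y z)
          (fun y z => r y z * v2 y z)
          0 x1 x2 /\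
  balance (fun y z => r y z * v1 y z ^ 2 + P y z)
          (fun y z => r y z * v1 y z * v2 y z)
          (- (beta * r x1 x2 * v2 x1 x2)) x1 x2 /\
  balance (fun y z => r y z * v1 y z * v2 y z)
          (fun y z => r y z * v2 y z ^ 2 + P y z)
          (beta * r x1 x2 * v1 x1 x2) x1 x2 /\
  balance (fun y z => r y z * v1 y z * E y z + v1 y z * P y z)
          (fun y z => r y z * v2 y z * E y z + v2 y z * P y z)
          0 x1 x2.

Definition solves_euler (beta gamma : R) (W : flow) (D : R -> R -> Prop) : Prop :=
  forall x1 x2, D x1 x2 -> euler_at beta gamma W x1 x2.

Definition Omega (L x1 x2 : R) : Prop := 0 < x1 < L /\ 0 < x2 < 1.
Definition Omega_minus (L xs x1 x2 : R) : Prop := Omega L x1 x2 /\ x1 < xs.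
Definition Omega_plus (L xs x1 x2 : R) : Prop := Omega L x1 x2 /\ xs < x1.

Record profile := Profile {
  dens : R -> R;
  vel : R -> R;
  pres : R -> R }.

Definition flow_of_profile (S : profile) : flow :=
  Flow (fun _ x2 => dens S x2) (fun _ x2 => vel S x2)
       (fun _ _ => 0) (fun _ x2 => pres S x2).

Definition mach (gamma : R) (S : profile) (x2 : R) : R :=
  vel S x2 / sqrt (gamma * pres S x2 / dens S x2).

Definition C1_positive (S : profile) : Prop :=
  Ck01 1 (dens S) /\ Ck01 1 (vel S) /\ Ck01 1 (pres S) /\
  (forall x2, I01 x2 -> 0 < dens S x2 /\ 0 < vel S x2 /\ 0 < pres S x2).

Definition special_normal_transonic_shock
    (beta gamma L : R) (Sm Sp : profile) (xs : R) : Prop :=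
  0 < xs < L /\
  C1_positive Sm /\ C1_positive Sp /\
  solves_euler beta gamma (flow_of_profile Sm) (Omega_minus L xs) /\
  solves_euler beta gamma (flow_of_profile Sp) (Omega_plus L xs) /\
  (forall x2, I01 x2 -> 1 < mach gamma Sm x2) /\
  (forall x2, I01 x2 -> mach gamma Sp x2 < 1).

Definition rankine_hugoniot (gamma : R) (Sm Sp : profile) (x2 : R) : Prop :=
  dens Sp x2 * vel Sp x2 = dens Sm x2 * vel Sm x2 /\
  dens Sp x2 * vel Sp x2 ^ 2 + pres Sp x2
    = dens Sm x2 * vel Sm x2 ^ 2 + pres Sm x2 /\
  / 2 * vel Sp x2 ^ 2 + gamma * pres Sp x2 / ((gamma - 1) * dens Sp x2)
    = / 2 * vel Sm x2 ^ 2 + gamma * pres Sm x2 / ((gamma - 1) * dens Sm x2).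

(* Main.v *)
(** The vertical momentum balance of a special solution reads
    [P' = - beta rho u] on both sides of the shock, and [rho u] is continuous
    across it, so the pressure jump is constant in [x2].  The jump conditions
    evaluate it as [2 / (gamma + 1) * (rho u^2 - gamma P)].  Constancy of
    [Q = rho u^2 - gamma P] turns [t = 1 / M^2 = gamma P / (rho u^2)] into
    [gamma P / (Q + gamma P)], and differentiating gives the equation for [t].
    Conversely that equation, being linear in [t - 1], propagates [t < 1] from
    [x2 = 1], and then [P = C t / (1 - t)], [rho = gamma P / (t u^2)] solve
    the momentum balance, with [C] fixed by the pressure at [x2 = 1]. *)

Require Import Defs.
From Stdlib Require Import Reals Lra.
From Coquelicot Require Import Coquelicot.

Open Scope R_scope.

(** * Differentiation within a set and $C^1$ functions on $[0,1]$ *)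

Lemma continue_in_inv (f : R -> R) (D : R -> Prop) (x : R) :
  continue_in f D x -> f x <> 0 -> continue_in (fun y => / f y) D x.
Proof. exact (limit_inv f (D_x D x) (f x) x). Qed.

Lemma D_in_congr (f g d e : R -> R) (D : R -> Prop) (x : R) :
  D x -> (forall y, D y -> f y = g y) -> d x = e x ->
  D_in f d D x -> D_in g e D x.
Proof.
intros Dx fg de Hf; unfold D_in; rewrite <- de.
apply limit1_ext with (2 := Hf).
intros y [Dy _]; now rewrite !fg.
Qed.

Lemma D_in_inv (f f' : R -> R) (D : R -> Prop) (x : R) :
  D x -> (forall y, D y -> f y <> 0) -> D_in f f' D x ->
  D_in (fun y => / f y) (fun y => - f' y * (/ f y * / f y)) D x.
Proof.
intros Dx nz Hf.
apply limit1_ext with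
  (f := fun y => - ((f y - f x) / (y - x)) * (/ f y * / f x)).
- intros y [Dy yx]; field; repeat split; auto; lra.
- apply limit_mul; [now apply limit_Ropp|].
  apply limit_mul; [|exact (limit_free (fun y => / f y) _ x x)].
  apply continue_in_inv; [exact (cont_deriv _ _ _ _ Hf)|auto].
Qed.

Lemma Ck01_1_const (c : R) : Ck01 1 (fun _ => c).
Proof.
exists (fun _ => 0); split; intros x _.
- apply Dconst.
- exact (limit_free (fun _ => 0) _ 0 x).
Qed.

Lemma Ck01_1_plus (f g : R -> R) :
  Ck01 1 f -> Ck01 1 g -> Ck01 1 (fun x => f x + g x).
Proof.
intros [f' [Hf Cf]] [g' [Hg Cg]].
exists (fun x => f' x + g' x); split; intros x Ix.
- apply Dadd; auto.
- apply limit_plus; [apply Cf|apply Cg]; auto.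
Qed.

Lemma Ck01_1_mult (f g : R -> R) :
  Ck01 1 f -> Ck01 1 g -> Ck01 1 (fun x => f x * g x).
Proof.
intros [f' [Hf Cf]] [g' [Hg Cg]].
exists (fun x => f' x * g x + f x * g' x); split; intros x Ix.
- apply Dmult; auto.
- apply limit_plus; apply limit_mul; try (now apply Cf); try (now apply Cg).
  + exact (cont_deriv _ _ _ _ (Hg x Ix)).
  + exact (cont_deriv _ _ _ _ (Hf x Ix)).
Qed.

Lemma Ck01_1_inv (f : R -> R) :
  (forall x, I01 x -> f x <> 0) -> Ck01 1 f -> Ck01 1 (fun x => / f x).
Proof.
intros nz [f' [Hf Cf]].
exists (fun y => - f' y * (/ f y * / f y)); split; intros x Ix.
- apply D_in_inv; auto.
- assert (Ci : continue_in (fun y => / f y) I01 x).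
  { apply continue_in_inv; auto. exact (cont_deriv _ _ _ _ (Hf x Ix)). }
  apply limit_mul; [apply limit_Ropp; now apply Cf|now apply limit_mul].
Qed.

Lemma Ck01_continue_in (k : nat) (f : R -> R) (x : R) :
  Ck01 k f -> I01 x -> continue_in f I01 x.
Proof.
destruct k as [|k]; [intros Hf; apply Hf|intros [f' [Hf _]] Ix].
exact (cont_deriv _ _ _ _ (Hf x Ix)).
Qed.

Lemma Ck01_1_of_S (k : nat) (f : R -> R) : Ck01 (S k) f -> Ck01 1 f.
Proof.
intros [f' [Hf Cf]]; exists f'; split; auto.
intros x Ix; now apply (Ck01_continue_in k).
Qed.

(** * From derivatives within $[0,1]$ to two-sided derivatives *)

(** Continuing [f] by its tangent lines at 0 and 1 turns the one-sided derivatives there into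
    two-sided ones, so that the classical mean value and intermediate value theorems apply up to the
    endpoints. *)
Lemma D_in_extension (f f' : R -> R) :
  (forall x, I01 x -> D_in f f' I01 x) ->
  exists F, forall x, I01 x -> F x = f x /\ is_derive F x (f' x).
Proof.
intros Hf.
set (F := fun x => if Rlt_dec x 0 then f 0 + f' 0 * x
                   else if Rlt_dec 1 x then f 1 + f' 1 * (x - 1) else f x).
assert (FI : forall x, I01 x -> F x = f x).
{ intros x [x0 x1]; unfold F.
  destruct (Rlt_dec x 0); [lra|]; destruct (Rlt_dec 1 x); [lra|easy]. }
exists F; intros x Ix; split; [now apply FI|].
apply is_derive_Reals; intros eps eps0.
destruct (Hf x Ix eps eps0) as [alp [alp0 Halp]].
(* An increment shorter than [r] leaves $[0,1]$ only when [x] is itself an endpoint; there the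
   extension is affine and its difference quotient is exactly [f' x]. *)
assert (Hr : exists r, 0 < r /\ (0 < x -> r <= x) /\ (x < 1 -> r <= 1 - x)).
{ destruct Ix as [x0 x1].
  destruct (Req_dec x 0); [exists 1; lra|].
  destruct (Req_dec x 1); [exists 1; lra|].
  exists (Rmin x (1 - x)); repeat split; intros.
  - apply Rmin_pos; lra.
  - apply Rmin_l.
  - apply Rmin_r. }
destruct Hr as [r [r0 [rx r1]]].
assert (d0 : 0 < Rmin alp r) by now apply Rmin_pos.
exists (mkposreal _ d0); simpl; intros h hn hd.
assert (hd1 := Rlt_le_trans _ _ _ hd (Rmin_l _ _)).
assert (hd2 := Rlt_le_trans _ _ _ hd (Rmin_r _ _)).
apply Rabs_def2 in hd2.
rewrite (FI x Ix).
destruct (Rlt_dec (x + h) 0) as [n|n].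
{ assert (xe : x = 0).
  { destruct Ix. destruct (Req_dec x 0); [easy|]. assert (r <= x) by (apply rx; lra). lra. }
  unfold F; destruct (Rlt_dec (x + h) 0); [|easy].
  rewrite xe; replace (_ - _) with 0 by (field; easy).
  now rewrite Rabs_R0. }
destruct (Rlt_dec 1 (x + h)) as [m|m].
{ assert (xe : x = 1).
  { destruct Ix. destruct (Req_dec x 1); [easy|]. assert (r <= 1 - x) by (apply r1; lra). lra. }
  unfold F; destruct (Rlt_dec (x + h) 0); [easy|].
  destruct (Rlt_dec 1 (x + h)); [|easy].
  rewrite xe; replace (_ - _) with 0 by (field; easy).
  now rewrite Rabs_R0. }
assert (Ih : I01 (x + h)) by (split; lra).
rewrite (FI _ Ih).
replace h with (x + h - x) at 2 by ring.
apply Halp; split.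
- split; [easy|lra].
- simpl; unfold Rdist; now replace (x + h - x) with h by ring.
Qed.

Lemma is_derive_interior (f f' : R -> R) (x : R) :
  (forall y, I01 y -> D_in f f' I01 y) -> 0 < x < 1 -> is_derive f x (f' x).
Proof.
intros Hf [x0 x1]; destruct (D_in_extension f f' Hf) as [F HF].
apply is_derive_ext_loc with F; [|apply HF; split; lra].
assert (L := locally_interval (fun y => F y = f y) x 0 1 x0 x1).
apply L; simpl; intros y y0 y1; apply HF; split; lra.
Qed.

Lemma MVT_I01 (f f' : R -> R) (x y : R) :
  (forall z, I01 z -> D_in f f' I01 z) -> I01 x -> I01 y ->
  exists c, I01 c /\ f y - f x = f' c * (y - x).
Proof.
intros Hf [x0 x1] [y0 y1]; destruct (D_in_extension f f' Hf) as [F HF].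
assert (m0 : 0 <= Rmin x y) by now apply Rmin_glb.
assert (m1 : Rmax x y <= 1) by now apply Rmax_lub.
destruct (MVT_gen F x y f') as [c [cI Hc]].
- intros z Hz; apply HF; split; lra.
- intros z Hz; apply derivable_continuous_pt.
  exists (f' z); apply is_derive_Reals, HF; split; lra.
- exists c; split; [split; lra|].
  now rewrite <- (proj1 (HF x (conj x0 x1))), <- (proj1 (HF y (conj y0 y1))).
Qed.

(** Every point of $[0,1]$ is a limit of interior points. This carries the Euler equations, imposed
    on the open nozzle only, to the walls $x_2=0,1$. *)
Lemma continue_in_eq_interior (f g : R -> R) (x : R) :
  (forall y, 0 < y < 1 -> f y = g y) -> I01 x ->
  continue_in f I01 x -> continue_in g I01 x -> f x = g x.
Proof.
intros fg [x0 x1] Cf Cg.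
set (D := fun y => 0 < y < 1 /\ x <> y).
assert (DI : forall y, D y -> D_x I01 x y).
{ intros y [Hy xy]; split; [split; lra|easy]. }
apply (single_limit f D _ _ x).
- intros alp alp0.
  assert (a0 : 0 < Rmin alp 1) by (apply Rmin_pos; lra).
  assert (a1 := Rmin_l alp 1); assert (a2 := Rmin_r alp 1).
  (* Moving towards the middle by at most 1/4 stays inside $(0,1)$. *)
  destruct (Rle_dec x (1 / 2)).
  + exists (x + Rmin alp 1 / 4); split; [split; lra|].
    unfold Rdist; apply Rabs_def1; lra.
  + exists (x - Rmin alp 1 / 4); split; [split; lra|].
    unfold Rdist; apply Rabs_def1; lra.
- now apply limit1_imp with (2 := Cf).
- apply limit1_ext with g; [intros y [Hy _]; symmetry; auto|].
  now apply limit1_imp with (2 := Cg).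
Qed.

(** Positivity travels backwards from 1, so an upper bound on [a] is enough. Comparison with
    $e^{Kx}$ replaces the integrating factor, and no integral of [a] is taken. *)
Lemma linear_ode_pos (a : R -> R) (K : R) (s : R -> R) :
  (forall x, I01 x -> a x <= K) ->
  (forall x, I01 x -> D_in s (fun y => a y * s y) I01 x) ->
  0 < s 1 -> forall x, I01 x -> 0 < s x.
Proof.
intros aK Hs s1.
destruct (D_in_extension _ _ Hs) as [F HF].
assert (I1 : I01 1) by (split; lra).
(* [s^2 exp (- 2 K x)] is nonincreasing whatever the sign of [s], so [s] has no zero. *)
set (h := fun y => F y ^ 2 * exp (- 2 * K * y)).
set (h' := fun y => 2 * (a y - K) * s y ^ 2 * exp (- 2 * K * y)).
assert (dh : forall y, I01 y -> is_derive h y (h' y)).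
{ intros y Iy; destruct (HF y Iy) as [Fy dF].
  unfold h, h'; auto_derive; [now exists (a y * s y)|].
  change (Derive _ y) with (Derive F y).
  rewrite (is_derive_unique F _ _ dF), Fy; ring. }
assert (nz : forall x, I01 x -> F x <> 0).
{ intros x Ix Fx.
  (* A zero of [F] at [x] would give $h(x)=0<h(1)$, against $h'\le 0$. *)
  destruct (MVT_gen h x 1 h') as [c [Hc E]].
  - intros y Hy; apply dh; destruct Ix.
    rewrite Rmin_left, Rmax_right in Hy by lra; split; lra.
  - intros y Hy; destruct Ix.
    rewrite Rmin_left, Rmax_right in Hy by lra.
    apply derivable_continuous_pt; exists (h' y).
    apply is_derive_Reals, dh; split; lra.
  - unfold h, h' in E; rewrite Fx, (proj1 (HF 1 I1)) in E; destruct Ix.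
    rewrite Rmin_left, Rmax_right in Hc by lra.
    assert (Ic : I01 c) by (split; lra).
    assert (0 < s 1 ^ 2 * exp (- 2 * K * 1)).
    { apply Rmult_lt_0_compat; [now apply pow_lt|apply exp_pos]. }
    assert (0 <= (K - a c) * (s c ^ 2 * exp (- 2 * K * c) * (1 - x))).
    { apply Rmult_le_pos; [specialize (aK c Ic); lra|].
      apply Rmult_le_pos; [|lra].
      apply Rmult_le_pos; [apply pow2_ge_0|apply Rlt_le, exp_pos]. }
    lra. }
intros x Ix; destruct (Rlt_dec 0 (s x)) as [|n]; [easy|exfalso].
rewrite <- (proj1 (HF x Ix)) in n; rewrite <- (proj1 (HF 1 I1)) in s1.
assert (Fx := nz x Ix); destruct Ix as [x0 x1].
assert (xl : x < 1) by (destruct (Req_dec x 1) as [e|]; [rewrite e in n|]; lra).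
destruct (Ranalysis5.IVT_interv F x 1) as [z [Hz Fz]]; try lra.
- intros y Hy; apply derivable_continuous_pt.
  exists (a y * s y); apply is_derive_Reals, HF; split; lra.
- apply (nz z); [split; lra|easy].
Qed.

(** * Mach number identities *)

Lemma sqrt_inv_sqr (m : R) : 0 < m -> sqrt (/ m ^ 2) = / m.
Proof.
intros m0; rewrite <- pow_inv; apply sqrt_pow2, Rlt_le, Rinv_0_lt_compat, m0.
Qed.

Lemma inv_mach_sqr (gamma : R) (S : profile) (x : R) :
  0 < gamma -> 0 < dens S x -> 0 < vel S x -> 0 < pres S x ->
  / mach gamma S x ^ 2 = gamma * pres S x / (dens S x * vel S x ^ 2).
Proof.
intros g r u P; unfold mach.
assert (a0 : 0 < gamma * pres S x / dens S x).
{ apply Rdiv_lt_0_compat; [now apply Rmult_lt_0_compat|easy]. }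
replace ((vel S x / sqrt (gamma * pres S x / dens S x)) ^ 2)
  with (vel S x ^ 2 / sqrt (gamma * pres S x / dens S x) ^ 2)
  by (field; now apply Rgt_not_eq, sqrt_lt_R0).
rewrite pow2_sqrt by lra.
field; repeat split; lra.
Qed.

Lemma mach_lt_1 (gamma : R) (S : profile) (x : R) :
  0 < gamma -> 0 < dens S x -> 0 < pres S x ->
  dens S x * vel S x ^ 2 < gamma * pres S x -> mach gamma S x < 1.
Proof.
intros g r P H; unfold mach.
assert (a0 : 0 < gamma * pres S x / dens S x).
{ apply Rdiv_lt_0_compat; [now apply Rmult_lt_0_compat|easy]. }
assert (s0 := sqrt_lt_R0 _ a0).
apply (Rdiv_lt_1 _ _ s0).
destruct (Rlt_dec (vel S x) 0); [lra|].
rewrite <- (sqrt_pow2 (vel S x)) by lra.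
apply sqrt_lt_1; [apply pow2_ge_0|lra|].
apply Rmult_lt_reg_l with (dens S x); [easy|].
replace (dens S x * (gamma * pres S x / dens S x))
  with (gamma * pres S x) by (field; lra).
easy.
Qed.

(** * The Euler system for states depending only on $x_2$ *)

Lemma balance_const_zero (c : R -> R) (x1 x2 : R) :
  balance (fun _ z => c z) (fun _ _ => 0) 0 x1 x2.
Proof.
exists 0, 0; split; [|split; [|ring]].
- exact (is_derive_const (c x2) x1).
- exact (is_derive_const 0 x2).
Qed.

Lemma balance_ext (F F' G G' : R -> R -> R) (s s' x1 x2 : R) :
  (forall y z, F y z = F' y z) -> (forall y z, G y z = G' y z) -> s = s' ->
  balance F G s x1 x2 -> balance F' G' s' x1 x2.
Proof.
intros HF HG <- [a [b [Ha [Hb E]]]]; exists a, b; split; [|split; [|easy]].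
- apply is_derive_ext with (2 := Ha); auto.
- apply is_derive_ext with (2 := Hb); auto.
Qed.

(** With $u_2=0$ and nothing depending on $x_1$, the balances of mass, horizontal momentum and
    energy are trivial; only vertical momentum has content. *)
Lemma euler_at_profile (beta gamma : R) (S : profile) (x1 x2 : R) :
  euler_at beta gamma (flow_of_profile S) x1 x2 <->
  is_derive (pres S) x2 (- (beta * dens S x2 * vel S x2)).
Proof.
split.
- intros [_ [_ [[a [b [Ha [Hb E]]]] _]]]; simpl in *.
  assert (a0 : a = 0).
  { rewrite <- (is_derive_unique _ _ _ Ha); apply is_derive_unique.
    exact (is_derive_const (dens S x2 * vel S x2 * 0) x1). }
  replace (- (beta * dens S x2 * vel S x2)) with b by lra.
  apply is_derive_ext with (2 := Hb); intros z.
  match goal with |- ?l = ?r => change (@eq R l r) end; ring.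
- intros HP; repeat split; simpl.
  + apply balance_ext with (4 := balance_const_zero (fun z => dens S z * vel S z) x1 x2);
      intros; ring.
  + apply balance_ext with
      (4 := balance_const_zero (fun z => dens S z * vel S z ^ 2 + pres S z) x1 x2);
      intros; ring.
  + exists 0, (- (beta * dens S x2 * vel S x2)); split; [|split; [|ring]].
    * exact (is_derive_const (dens S x2 * vel S x2 * 0) x1).
    * apply is_derive_ext with (2 := HP); intros z.
      match goal with |- ?l = ?r => change (@eq R l r) end; ring.
  + apply balance_ext with (4 := balance_const_zero (fun z =>
        dens S z * vel S z * energy gamma (flow_of_profile S) 0 z + vel S z * pres S z) x1 x2);
      intros; try ring; reflexivity.
Qed.

(** One vertical segment inside [D] suffices. Both sides of the momentum balance are continuous on
    $[0,1]$, so it persists at the endpoints. *)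
Lemma pres_D_in (beta gamma : R) (S : profile) (D : R -> R -> Prop) (x1 : R) :
  C1_positive S -> (forall x2, 0 < x2 < 1 -> D x1 x2) ->
  solves_euler beta gamma (flow_of_profile S) D ->
  forall x, I01 x ->
    D_in (pres S) (fun y => - (beta * dens S y * vel S y)) I01 x.
Proof.
intros [Cr [Cu [[p' [Hp Cp]] _]]] HD HE x Ix.
apply D_in_congr with (4 := Hp x Ix); auto.
apply (continue_in_eq_interior p' (fun y => - (beta * dens S y * vel S y))); auto.
- intros y Hy.
  rewrite <- (is_derive_unique _ _ _ (is_derive_interior _ _ y Hp Hy)).
  apply is_derive_unique, (euler_at_profile beta gamma S x1); auto.
- apply limit_Ropp, limit_mul; [|now apply (Ck01_continue_in 1)].
  apply limit_mul; [exact (limit_free (fun _ => beta) _ 0 x)|].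
  now apply (Ck01_continue_in 1).
Qed.

(** * Algebra of the jump conditions *)

(** Once mass and momentum have eliminated [r'] and [P'], the energy condition is quadratic in [u']
    with the trivial root [u]. Dividing that root out leaves a linear equation for [u']. *)
Lemma pressure_jump (gamma r u P r' u' P' : R) :
  1 < gamma -> 0 < r -> 0 < u -> 0 < r' -> 0 < u' -> u' <> u ->
  r' * u' = r * u ->
  r' * u' ^ 2 + P' = r * u ^ 2 + P ->
  / 2 * u' ^ 2 + gamma * P' / ((gamma - 1) * r')
    = / 2 * u ^ 2 + gamma * P / ((gamma - 1) * r) ->
  P' - P = 2 / (gamma + 1) * (r * u ^ 2 - gamma * P).
Proof.
intros g r0 u0 r0' u0' uu mass mom en.
assert (m0 : 0 < r * u) by now apply Rmult_lt_0_compat.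
assert (EP : P' = P + r * u * (u - u')).
{ replace (r' * u' ^ 2) with (r' * u' * u') in mom by ring.
  rewrite mass in mom; lra. }
assert (Er : r' = r * u / u') by (rewrite <- mass; field; lra).
rewrite Er, EP in en.
(* This is the difference of the two sides of the energy condition, multiplied by $(\gamma-1)\rho
   u$. *)
assert (E2 : (u' - u) *
   ((gamma - 1) * (u' + u) / 2 * (r * u) + gamma * P - gamma * (r * u) * u') = 0).
{ apply Rmult_eq_reg_l with (/ ((gamma - 1) * r * u));
    [|apply Rinv_neq_0_compat; repeat apply Rmult_integral_contrapositive_currified; lra].
  rewrite Rmult_0_r; apply Rminus_diag_eq in en; rewrite <- en; field; lra. }
apply Rmult_integral in E2; destruct E2 as [E2|E2]; [lra|].
rewrite EP; apply Rmult_eq_reg_l with (gamma + 1); [|lra].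
field_simplify; lra.
Qed.

(** * Necessity: a shock forces the Mach number equation *)

Lemma mach_ode_of_shock (beta gamma L : R) (Sm Sp : profile) (xs : R) :
  1 < gamma ->
  special_normal_transonic_shock beta gamma L Sm Sp xs ->
  (forall x, I01 x -> rankine_hugoniot gamma Sm Sp x) ->
  forall x, I01 x ->
    D_in (fun y => / mach gamma Sm y ^ 2)
         (fun y => beta * gamma / vel Sm y * (/ mach gamma Sm y ^ 2 - 1)) I01 x.
Proof.
intros g [xsL [Cm [Cp [Em [Ep [Mm Mp]]]]]] RH.
assert (posm := proj2 (proj2 (proj2 Cm))).
assert (posp := proj2 (proj2 (proj2 Cp))).
assert (Dm := pres_D_in beta gamma Sm (Omega_minus L xs) (xs / 2) Cm
  ltac:(intros; repeat split; lra) Em).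
assert (Dp := pres_D_in beta gamma Sp (Omega_plus L xs) ((xs + L) / 2) Cp
  ltac:(intros; repeat split; lra) Ep).
assert (J : forall x, I01 x -> pres Sp x - pres Sm x
   = 2 / (gamma + 1) * (dens Sm x * vel Sm x ^ 2 - gamma * pres Sm x)).
{ intros x Ix; destruct (RH x Ix) as [m [p e]].
  destruct (posm x Ix) as [a [b c]], (posp x Ix) as [a' [b' c']].
  apply (pressure_jump gamma _ _ _ (dens Sp x) (vel Sp x)); auto.
  (* Equal velocities would force equal densities and pressures, hence equal Mach numbers, although
     one exceeds 1 and the other does not. *)
  intros uu; specialize (Mm x Ix); specialize (Mp x Ix).
  rewrite uu in m, p; apply Rmult_eq_reg_r in m; [|lra].
  rewrite m in p; apply Rplus_eq_reg_l in p.
  unfold mach in *; rewrite uu, m, p in Mp; lra. }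
set (Q := dens Sm 1 * vel Sm 1 ^ 2 - gamma * pres Sm 1).
assert (I1 : I01 1) by (split; lra).
assert (HQ : forall x, I01 x -> dens Sm x * vel Sm x ^ 2 = Q + gamma * pres Sm x).
{ intros x Ix.
  (* By conservation of mass the two momentum sources cancel at [c], so the pressure jump at [x]
     equals the one at 1. *)
  destruct (MVT_I01 (fun y => pres Sp y - pres Sm y)
    (fun y => - (beta * dens Sp y * vel Sp y) - - (beta * dens Sm y * vel Sm y))
    x 1) as [c [Ic E]]; auto.
  { intros z Iz; apply Dminus; auto. }
  destruct (RH c Ic) as [m _].
  rewrite !J in E by easy; fold Q in E.
  rewrite !Rmult_assoc, m, Rminus_diag, Rmult_0_l in E.
  apply Rminus_diag_uniq in E.
  apply Rmult_eq_reg_l in E; [lra|].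
  apply Rgt_not_eq, Rdiv_lt_0_compat; lra. }
assert (HD : forall x, I01 x -> 0 < Q + gamma * pres Sm x).
{ intros x Ix; rewrite <- HQ by easy; destruct (posm x Ix) as [a [b c]].
  apply Rmult_lt_0_compat; [easy|now apply pow_lt]. }
intros x Ix; destruct (posm x Ix) as [a [b c]].
assert (Dd : D_in (fun y => Q + gamma * pres Sm y)
  (fun y => 0 + gamma * - (beta * dens Sm y * vel Sm y)) I01 x).
{ apply Dadd; [apply Dconst|apply Dmult_const; auto]. }
assert (Di := D_in_inv _ _ _ _ Ix
  (fun y Iy => Rgt_not_eq _ _ (HD y Iy)) Dd).
apply D_in_congr with
  (4 := Dmult _ _ _ _ _ _ (Dmult_const _ _ _ _ gamma (Dm x Ix)) Di); auto.
- intros y Iy; destruct (posm y Iy) as [a' [b' c']].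
  rewrite inv_mach_sqr, HQ by (auto; lra); reflexivity.
- cbv beta; rewrite inv_mach_sqr by (auto; lra).
  rewrite <- HQ by easy.
  (* The quotient rule gives $t'=\gamma P'Q/(\rho u^2)^2$; then $P'=-\beta\rho u$ and $Q=\rho
     u^2(1-t)$ yield the equation. *)
  replace Q with (dens Sm x * vel Sm x ^ 2 - gamma * pres Sm x)
    by (rewrite (HQ x Ix); ring).
  field; lra.
Qed.

(** * Sufficiency: construction of the shock from the Mach number equation *)

Lemma shock_of_mach_ode (beta gamma L : R) (um : R -> R) (umin P1 : R) (Mm : R -> R) :
  0 < beta -> 1 < gamma -> 0 < L -> Ck01 1 um ->
  0 < umin -> (forall x, I01 x -> umin <= um x) -> 0 < P1 ->
  (forall x, I01 x -> 0 < Mm x) -> 1 < Mm 1 ->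
  (forall x, I01 x ->
     D_in (fun y => / (Mm y ^ 2))
          (fun y => beta * gamma / um y * (/ (Mm y ^ 2) - 1)) I01 x) ->
  exists (Sm Sp : profile) (xs : R),
    special_normal_transonic_shock beta gamma L Sm Sp xs /\
    (forall x2, I01 x2 -> vel Sm x2 = um x2) /\
    (forall x2, I01 x2 -> mach gamma Sm x2 = Mm x2) /\
    pres Sm 1 = P1 /\
    (forall x2, I01 x2 -> rankine_hugoniot gamma Sm Sp x2).
Proof.
intros b0 g L0 Cu umin0 hmin P10 M0 M1 ode.
set (t := fun y => / Mm y ^ 2) in *.
assert (I1 : I01 1) by (split; lra).
assert (u0 : forall x, I01 x -> 0 < um x).
{ intros x Ix; specialize (hmin x Ix); lra. }
assert (t0 : forall x, I01 x -> 0 < t x).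
{ intros x Ix; apply Rinv_0_lt_compat, pow_lt; auto. }
assert (s0 : forall x, I01 x -> 0 < 1 - t x).
{ apply (linear_ode_pos (fun y => beta * gamma / um y) (beta * gamma / umin)).
  - intros x Ix; apply Rmult_le_compat_l; [apply Rmult_le_pos; lra|].
    apply Rinv_le_contravar; auto.
  - intros x Ix; apply D_in_congr with
      (4 := Dminus _ _ _ _ _ _ (Dconst I01 1 x) (ode x Ix)); auto.
    unfold t; ring.
  - assert (t 1 < 1); [|lra].
    assert (H : / Mm 1 ^ 2 < / 1); [|now rewrite Rinv_1 in H].
    apply Rinv_lt_contravar; [rewrite Rmult_1_l; apply pow_lt; auto|].
    apply Rlt_pow_R1; auto. }
(* The equation itself exhibits $t'$ as a continuous function. *)
assert (Ct : Ck01 1 t).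
{ exists (fun y => beta * gamma / um y * (t y - 1)); split; [exact ode|].
  intros x Ix; apply limit_mul.
  - apply limit_mul; [exact (limit_free (fun _ => beta * gamma) _ 0 x)|].
    apply continue_in_inv; [now apply (Ck01_continue_in 1)|].
    specialize (u0 x Ix); lra.
  - apply limit_minus; [exact (cont_deriv _ _ _ _ (ode x Ix))|].
    exact (limit_free (fun _ => 1) _ 0 x). }
assert (Cs : Ck01 1 (fun y => / (1 + -1 * t y))).
{ apply Ck01_1_inv; [intros x Ix; specialize (s0 x Ix); lra|].
  apply Ck01_1_plus; [apply Ck01_1_const|].
  apply Ck01_1_mult; [apply Ck01_1_const|easy]. }
(* $\gamma C$ is the constant value of $Q$, since $\rho u^2-\gamma P=\gamma P(1-t)/t$. *)
assert (HC : exists C, 0 < C /\ C = P1 * (1 - t 1) / t 1).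
{ eexists; split; [|reflexivity].
  apply Rdiv_lt_0_compat; [apply Rmult_lt_0_compat|]; auto. }
destruct HC as [C [C0 HC]].
set (pm := fun y => C * t y * / (1 + -1 * t y)).
set (rm := fun y => gamma * C * (/ um y * / um y) * / (1 + -1 * t y)).
(* Prandtl's relation [u_+ u_- = c_*^2], expressed through [t]. *)
set (up := fun y => / (gamma + 1) * um y * (gamma - 1 + 2 * t y)).
(* Conservation of mass dictates [rp], and the constant jump $2Q/(\gamma+1)$ with $Q=\gamma C$
   dictates [pp]. *)
set (rp := fun y => rm y * um y * / up y).
set (pp := fun y => pm y + 2 * gamma * C / (gamma + 1)).
assert (Cpm : Ck01 1 pm).
{ apply Ck01_1_mult; [apply Ck01_1_mult; [apply Ck01_1_const|]|]; easy. }
assert (Crm : Ck01 1 rm).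
{ assert (Ci : Ck01 1 (fun y => / um y)).
  { apply Ck01_1_inv; auto; intros x Ix; specialize (u0 x Ix); lra. }
  apply Ck01_1_mult; [apply Ck01_1_mult; [apply Ck01_1_const|]|easy].
  now apply Ck01_1_mult. }
assert (Cup : Ck01 1 up).
{ apply Ck01_1_mult; [apply Ck01_1_mult; [apply Ck01_1_const|easy]|].
  apply Ck01_1_plus; [apply Ck01_1_const|].
  apply Ck01_1_mult; [apply Ck01_1_const|easy]. }
assert (pm0 : forall x, I01 x -> 0 < pm x).
{ intros x Ix; specialize (s0 x Ix); specialize (t0 x Ix).
  apply Rmult_lt_0_compat; [now apply Rmult_lt_0_compat|].
  apply Rinv_0_lt_compat; lra. }
assert (rm0 : forall x, I01 x -> 0 < rm x).
{ intros x Ix; specialize (s0 x Ix); specialize (u0 x Ix).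
  apply Rinv_0_lt_compat in u0.
  apply Rmult_lt_0_compat; [|apply Rinv_0_lt_compat; lra].
  repeat apply Rmult_lt_0_compat; lra. }
assert (up0 : forall x, I01 x -> 0 < up x).
{ intros x Ix; specialize (t0 x Ix); specialize (u0 x Ix).
  repeat apply Rmult_lt_0_compat; try lra; apply Rinv_0_lt_compat; lra. }
assert (rp0 : forall x, I01 x -> 0 < rp x).
{ intros x Ix; apply Rmult_lt_0_compat; [apply Rmult_lt_0_compat; auto|].
  apply Rinv_0_lt_compat; auto. }
assert (J0 : 0 < 2 * gamma * C / (gamma + 1)).
{ apply Rdiv_lt_0_compat; [repeat apply Rmult_lt_0_compat|]; lra. }
assert (pp0 : forall x, I01 x -> 0 < pp x).
{ intros x Ix; specialize (pm0 x Ix); unfold pp; lra. }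
assert (Cmp : C1_positive (Profile rm um pm)) by (repeat split; simpl; auto).
assert (Cpp : C1_positive (Profile rp up pp)).
{ split; [|split; [easy|split; [|repeat split; simpl; auto]]].
  - apply Ck01_1_mult; [now apply Ck01_1_mult|].
    apply Ck01_1_inv; auto; intros x Ix; specialize (up0 x Ix); lra.
  - apply Ck01_1_plus; [easy|apply Ck01_1_const]. }
assert (dpm : forall x, 0 < x < 1 -> is_derive pm x (- (beta * rm x * um x))).
{ intros x Hx; assert (Ix : I01 x) by (split; lra).
  assert (dt : is_derive t x (beta * gamma / um x * (t x - 1)))
    by exact (is_derive_interior _ _ x ode Hx).
  specialize (s0 x Ix); specialize (u0 x Ix).
  unfold pm; auto_derive.
  - repeat split; [eexists; exact dt..|lra].
  - change (Derive _ x) with (Derive t x).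
    (* $C\,t'/(1-t)^2=-\beta\gamma C/(u(1-t))$, which is $-\beta\rho u$ for the chosen density. *)
    rewrite (is_derive_unique t _ _ dt); unfold rm; field; lra. }
assert (machm : forall x, I01 x -> mach gamma (Profile rm um pm) x = Mm x).
{ intros x Ix; unfold mach; simpl.
  specialize (s0 x Ix); specialize (u0 x Ix); specialize (M0 x Ix).
  replace (gamma * pm x / rm x) with (um x ^ 2 * / Mm x ^ 2)
    by (fold (t x); unfold pm, rm; field; lra).
  rewrite sqrt_mult_alt, sqrt_pow2, sqrt_inv_sqr by (auto using pow2_ge_0; lra).
  field; lra. }
(* The profiles do not depend on $x_1$, so any location in $(0,L)$ would serve. *)
exists (Profile rm um pm), (Profile rp up pp), (L / 2).
split; [|split; [easy|split; [easy|split]]].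
- split; [lra|split; [easy|split; [easy|split; [|split; [|split]]]]].
  + intros x1 x2 [[_ Hx] _]; apply euler_at_profile; simpl; auto.
  + intros x1 x2 [[_ Hx] _]; apply euler_at_profile; simpl.
    assert (Ix : I01 x2) by (split; lra).
    (* Equal mass fluxes and a constant pressure jump reduce the downstream balance to the upstream
       one. *)
    replace (beta * rp x2 * up x2) with (beta * rm x2 * um x2)
      by (specialize (up0 x2 Ix); unfold rp; field; lra).
    assert (dp := dpm x2 Hx); unfold pp; auto_derive; [eexists; exact dp|].
    change (Derive _ x2) with (Derive pm x2).
    rewrite (is_derive_unique pm _ _ dp); ring.
  + intros x Ix; rewrite machm by easy.
    specialize (s0 x Ix); specialize (M0 x Ix).
    destruct (Rlt_dec 1 (Mm x)) as [|n]; [easy|exfalso].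
    assert (H : / 1 <= t x); [|lra].
    unfold t; apply Rinv_le_contravar; [now apply pow_lt|].
    rewrite <- (pow1 2); apply pow_incr; lra.
  + intros x Ix; apply mach_lt_1; cbn [dens vel pres]; auto; [lra|].
    specialize (s0 x Ix); specialize (u0 x Ix); specialize (t0 x Ix);
      specialize (up0 x Ix).
    apply Rminus_lt_0.
    (* The shock reverses the sign of $\rho u^2-\gamma P$: it is $\gamma C$ upstream and $-\gamma C$
       downstream, hence subsonic flow. *)
    replace (gamma * pp x - rp x * up x ^ 2) with (gamma * C);
      [apply Rmult_lt_0_compat; lra|].
    replace (rp x * up x ^ 2) with (rm x * um x * up x) by (unfold rp; field; lra).
    unfold pp, pm, rm, up; field; lra.
- simpl; unfold pm; rewrite HC; specialize (s0 1 I1); specialize (t0 1 I1).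
  field; lra.
- intros x Ix; unfold rankine_hugoniot; simpl.
  specialize (s0 x Ix); specialize (u0 x Ix); specialize (t0 x Ix).
  assert (w0 : 0 < gamma - 1 + 2 * t x) by lra.
  unfold rp, pp, pm, rm, up; repeat split; field; lra.
Qed.

Theorem lemma2p1 (beta gamma L : R)
    (hbeta : 0 < beta) (hgamma : 1 < gamma) (hL : 0 < L)
    (um : R -> R) (hum : Ck01 3 um)
    (umin : R) (humin : is_min01 um umin) (humin_pos : 0 < umin)
    (P1 : R) (hP1 : 0 < P1)
    (Mm : R -> R) (hMm : forall x2, I01 x2 -> 0 < Mm x2) (hMm1 : 1 < Mm 1) :
  (exists (Sm Sp : profile) (xs : R),
      special_normal_transonic_shock beta gamma L Sm Sp xs /\
      (forall x2, I01 x2 -> vel Sm x2 = um x2) /\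
      (forall x2, I01 x2 -> mach gamma Sm x2 = Mm x2) /\
      pres Sm 1 = P1 /\
      (forall x2, I01 x2 -> rankine_hugoniot gamma Sm Sp x2))
  <->
  (forall x2, I01 x2 ->
      D_in (fun y => / (Mm y ^ 2))
           (fun y => beta * gamma / um y * (/ (Mm y ^ 2) - 1))
           I01 x2).
Proof.
split.
- intros [Sm [Sp [xs [shock [Hu [HM [_ RH]]]]]]] x Ix.
  apply D_in_congr with
    (4 := mach_ode_of_shock beta gamma L Sm Sp xs hgamma shock RH x Ix); auto.
  + intros y Iy; now rewrite HM.
  + now rewrite Hu, HM.
- apply shock_of_mach_ode with umin; auto.
  + now apply (Ck01_1_of_S 2).
  + apply humin.
Qed.
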